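(* For positive reals $\varepsilon,T$ let $\delta(\varepsilon,T):=\min\{\varepsilon/2,\ \varepsilon^3/(240T^5)\}$. Let $\Gamma\in\mathbb{R}^{p\times p}$ be a connected continuous-time interconnection, $r\in\mathbb{R}^p$ with $r^T\Gamma=0$, $r^T\mathbf 1=1$, and $\Omega$ symmetric positive definite with $(\Gamma-\mathbf 1r^T)^T\Omega+\Omega(\Gamma-\mathbf 1r^T)=-I_p$. Let $\rho(\Gamma):=\sigma_{\max}(\Omega)\max\{1,|\Gamma|^3\}$ and $V(\mathbf x):=\mathbf x^T(\Omega\otimes I_n)\mathbf x$. Then for every Riemann-integrable $Q:\mathbb{R}_{\ge0}\to\overline{\mathcal Q}_n$ with $\sigma_{\min}\big(\int_0^TQ_t\,dt\big)\ge\varepsilon$, the solution of $\dot{\mathbf x}=(\Gamma\otimes Q_t)\mathbf x$ satisfies $$V(\mathbf x(T)-\bar{\mathbf x})\le\Big(1-\frac{\delta(\varepsilon,T)}{\rho(\Gamma)}\Big)V(\mathbf x(0)-\bar{\mathbf x}),$$ where $\bar{\mathbf x}:=(\mathbf 1r^T\otimes I_n)\mathbf x(0)$.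
   Context: $|\cdot|$ Euclidean norm / induced 2-norm; $\mathbf 1$ all-ones vector; $\otimes$ Kronecker product; $\sigma_{\max},\sigma_{\min}$ largest/smallest singular values; $\mathcal Q_n$ symmetric positive semidefinite $n\times n$ matrices and $\overline{\mathcal Q}_n=\{R\in\mathcal Q_n:|R|\le1\}$. A continuous-time interconnection: $\gamma_{ij}\ge0$ ($i\ne j$), $\gamma_{ii}=-\sum_{j\ne i}\gamma_{ij}$; graph edge $(n_i,n_j)$ iff $\gamma_{ij}>0$; connected means some node is reachable by directed path from every other node. *)

(* Defs.v *)
From Stdlib Require Import Reals.
From Coquelicot Require Import Hierarchy RInt.
From HB Require Import structures.
From mathcomp Require Import all_boot all_order all_algebra.
From mathcomp Require Import classical_sets reals Rstruct mxtens.
Set Implicit Arguments. Unset Strict Implicit. Unset Printing Implicit Defensive.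
Import Order.TTheory GRing.Theory Num.Theory.
Local Open Scope ring_scope.

Notation RInt := Coquelicot.RInt.RInt.
Notation ex_RInt := Coquelicot.RInt.ex_RInt.
Notation is_RInt := Coquelicot.RInt.is_RInt.

Definition vnorm {m : nat} (v : 'cV[R]_m) : R :=
  Num.sqrt (\sum_(i < m) v i 0 ^+ 2).

Definition opnorm {m k : nat} (A : 'M[R]_(m, k)) : R :=
  sup [set vnorm (A *m v) | v in [set v : 'cV[R]_k | vnorm v <= 1]].

Definition singular_value {m k : nat} (A : 'M[R]_(m, k)) (s : R) : Prop :=
  0 <= s /\ eigenvalue (A^T *m A) (s ^+ 2).

Definition sigma_max {m k : nat} (A : 'M[R]_(m, k)) : R :=
  sup [set s | singular_value A s].
Definition sigma_min {m k : nat} (A : 'M[R]_(m, k)) : R :=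
  inf [set s | singular_value A s].

Definition psd {m : nat} (A : 'M[R]_m) : Prop :=
  A^T = A /\ forall v : 'cV[R]_m, 0 <= (v^T *m A *m v) 0 0.
Definition pd {m : nat} (A : 'M[R]_m) : Prop :=
  A^T = A /\ forall v : 'cV[R]_m, v != 0 -> 0 < (v^T *m A *m v) 0 0.

Definition Qbar (m : nat) (A : 'M[R]_m) : Prop := psd A /\ opnorm A <= 1.

Definition interconnection {p : nat} (G : 'M[R]_p) : Prop :=
  (forall i j : 'I_p, i != j -> 0 <= G i j) /\
  (forall i : 'I_p, G i i = - \sum_(j < p | j != i) G i j).

Definition edge {p : nat} (G : 'M[R]_p) : rel 'I_p := fun i j => 0 < G i j.

Definition connected_ic {p : nat} (G : 'M[R]_p) : Prop :=
  interconnection G /\ exists k : 'I_p, forall i : 'I_p, connect (edge G) i k.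

Definition ones (m : nat) : 'cV[R]_m := const_mx 1.

Definition delta (eps T : R) : R :=
  Num.min (eps / 2) (eps ^+ 3 / (240 * T ^+ 5)).

Definition rho {p : nat} (G Om : 'M[R]_p) : R :=
  sigma_max Om * Num.max 1 (opnorm G ^+ 3).

Definition Vfun {p n : nat} (Om : 'M[R]_p) (x : 'cV[R]_(p * n)) : R :=
  (x^T *m (Om *t (1%:M : 'M[R]_n)) *m x) 0 0.

Definition riemann_int_mx {n : nat} (Q : R -> 'M[R]_n) : Prop :=
  forall (b : R) (i j : 'I_n), 0 <= b -> ex_RInt (fun t => Q t i j) 0 b.

Definition int_mx {n : nat} (Q : R -> 'M[R]_n) (a b : R) : 'M[R]_n :=
  \matrix_(i, j) RInt (fun t => Q t i j) a b.

(* x is a (Caratheodory) solution on R_{>=0} of  x' = (G (x) Q_t) x :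
   x(t) = x(0) + int_0^t (G (x) Q_s) x(s) ds for all t >= 0 *)
Definition is_solution {p n : nat} (G : 'M[R]_p) (Q : R -> 'M[R]_n)
    (x : R -> 'cV[R]_(p * n)) : Prop :=
  forall (t : R) (k : 'I_(p * n)), 0 <= t ->
    is_RInt (fun s => ((G *t Q s) *m x s) k 0) 0 t (x t k 0 - x 0 k 0).

(* Main.v *)
Require Import Defs.
From Stdlib Require Import Reals.
From Coquelicot Require Import Hierarchy RInt.
From HB Require Import structures.
From mathcomp Require Import all_boot all_order all_algebra.
From mathcomp Require Import classical_sets reals Rstruct mxtens ring lra.
Set Implicit Arguments. Unset Strict Implicit. Unset Printing Implicit Defensive.
Import Order.TTheory GRing.Theory Num.Theory.
Local Open Scope ring_scope.

(** Written as a p x n matrix, the error y = x - xbar satisfies y' = G y Q_t and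
    r^T y = 0, so the Lyapunov equation gives dV/dt = - tr (y Q_t y^T). Let D be
    the decrease of V over [0, T]. Since Q_t^2 <= Q_t, Cauchy-Schwarz gives
    |y(t) - y(0)|^2 <= |G|^2 T D, and the triangle inequality for the seminorm
    y |-> int tr (y Q_t y^T) then gives
    eps |y(0)|^2 <= tr (y(0) (int Q) y(0)^T) <= (1 + |G| T)^2 D.
    As eps <= T, an elementary estimate turns this into the claimed rate.

    Q is only Riemann integrable, so y need not be differentiable. Instead of
    differentiating, each inequality f T <= f 0 is obtained from
    f t - f s <= C (t - s)^2, where the increments are computed from
    y(t) - y(s) = G y(s) (int_s^t Q) + O((t - s)^2). *)

(** * Quadratic forms on matrices and the least eigenvalue of a symmetric matrix *)

(** The trace lets one notion serve both vectors and the p x n error matrix; [qf 1%:M X] is the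
    squared Frobenius norm of [X]. *)
Definition qf {K : nzRingType} {m k} (A : 'M[K]_m) (X : 'M[K]_(m, k)) : K :=
  \tr (X^T *m A *m X).

Lemma qf_mulmx (K : comNzRingType) m k l (A : 'M[K]_m) (B : 'M[K]_(m, l))
    (X : 'M[K]_(l, k)) :
  qf A (B *m X) = qf (B^T *m A *m B) X.
Proof. by rewrite /qf trmx_mul !mulmxA. Qed.

Section QuadraticForm.
Variables (K : realFieldType) (m : nat).
Implicit Types (A B : 'M[K]_m).

Lemma qf_cV A (v : 'cV[K]_m) : qf A v = (v^T *m A *m v) 0 0.
Proof. by rewrite /qf /mxtrace big_ord1. Qed.

Lemma qf_cols k A (X : 'M[K]_(m, k)) : qf A X = \sum_j qf A (col j X).
Proof.
apply: eq_bigr => j _; rewrite qf_cV !mxE; apply: eq_bigr => i _.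
rewrite !mxE; congr (_ * _); apply: eq_bigr => l _; by rewrite !mxE.
Qed.

Lemma qf_ge0 k A (X : 'M[K]_(m, k)) :
  (forall v : 'cV[K]_m, 0 <= qf A v) -> 0 <= qf A X.
Proof. by move=> A0; rewrite qf_cols sumr_ge0. Qed.

Lemma qfD k A B (X : 'M[K]_(m, k)) : qf (A + B) X = qf A X + qf B X.
Proof. by rewrite /qf mulmxDr mulmxDl mxtraceD. Qed.

Lemma qfZ k a A (X : 'M[K]_(m, k)) : qf (a *: A) X = a * qf A X.
Proof. by rewrite /qf -scalemxAr -scalemxAl mxtraceZ. Qed.

Lemma qfN k A (X : 'M[K]_(m, k)) : qf (- A) X = - qf A X.
Proof. by rewrite -scaleN1r qfZ mulN1r. Qed.

Lemma qfB k A B (X : 'M[K]_(m, k)) : qf (A - B) X = qf A X - qf B X.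
Proof. by rewrite qfD qfN. Qed.

Lemma qf_scalar k a (X : 'M[K]_(m, k)) : qf a%:M X = a * qf 1%:M X.
Proof. by rewrite -(scalemx1 _ a) qfZ. Qed.

Lemma qf1E k (X : 'M[K]_(m, k)) : qf 1%:M X = \tr (X^T *m X).
Proof. by rewrite /qf mulmx1. Qed.

Lemma qf1_sum k (X : 'M[K]_(m, k)) : qf 1%:M X = \sum_j \sum_i X i j ^+ 2.
Proof.
rewrite qf1E; apply: eq_bigr => j _; rewrite !mxE; apply: eq_bigr => i _.
by rewrite !mxE expr2.
Qed.

Lemma qf1_ge0 k (X : 'M[K]_(m, k)) : 0 <= qf 1%:M X.
Proof. by rewrite qf1_sum; do 2!(apply: sumr_ge0 => ? _); rewrite sqr_ge0. Qed.

Lemma qf1_ge_sqr k (X : 'M[K]_(m, k)) i j : X i j ^+ 2 <= qf 1%:M X.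
Proof.
rewrite qf1_sum (bigD1 j) //= (bigD1 i) //= -addrA lerDl addr_ge0 //.
  by apply: sumr_ge0 => ? _; rewrite sqr_ge0.
by do 2!(apply: sumr_ge0 => ? _); rewrite sqr_ge0.
Qed.

Lemma qf1_eq0 k (X : 'M[K]_(m, k)) : qf 1%:M X = 0 -> X = 0.
Proof.
move=> X0; apply/matrixP => i j; rewrite mxE.
have := qf1_ge_sqr X i j; rewrite X0 => h.
by apply/eqP; rewrite -sqrf_eq0 eq_le h sqr_ge0.
Qed.

Lemma qf1_gt0 k (X : 'M[K]_(m, k)) : X != 0 -> 0 < qf 1%:M X.
Proof.
move=> X0; rewrite lt_def qf1_ge0 andbT; apply: contra X0 => /eqP h.
by rewrite (qf1_eq0 h).
Qed.

Lemma qfDr k A (X Y : 'M[K]_(m, k)) : A^T = A ->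
  qf A (X + Y) = qf A X + 2 * \tr (X^T *m A *m Y) + qf A Y.
Proof.
move=> At; rewrite /qf [(X + Y)^T]linearD /= mulmxDl mulmxDl !mulmxDr !mxtraceD.
have -> : \tr (Y^T *m A *m X) = \tr (X^T *m A *m Y).
  by rewrite -mxtrace_tr !trmx_mul trmxK At mulmxA.
ring.
Qed.

Lemma qfZr k a A (X : 'M[K]_(m, k)) : qf A (a *: X) = a ^+ 2 * qf A X.
Proof.
rewrite /qf [(a *: X)^T]linearZ /= -!scalemxAl -!scalemxAr !mxtraceZ.
by rewrite mulrA -expr2.
Qed.

(** A crude constant for qualitative purposes only: it shows that sets are bounded, so that suprema
    make sense, and that some positive constant exists. *)
Definition entry_sum A : K := \sum_i \sum_j `|A i j|.

Lemma qf_le_entry_sum A (v : 'cV[K]_m) :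
  `|qf A v| <= entry_sum A * qf 1%:M v.
Proof.
rewrite qf_cV !mxE /entry_sum exchange_big mulr_suml /=.
apply: le_trans (ler_norm_sum _ _ _) _.
apply: ler_sum => j _; rewrite !mxE normrM mulr_suml.
apply: (@le_trans _ _ (\sum_i `|v i 0| * `|A i j| * `|v j 0|)).
  rewrite -mulr_suml ler_wpM2r //; apply: le_trans (ler_norm_sum _ _ _) _.
  by apply: ler_sum => i _; rewrite !mxE normrM.
apply: ler_sum => i _.
rewrite mulrAC [_ * `|A _ _|]mulrC ler_wpM2l //.
have hi := qf1_ge_sqr v i 0; have hj := qf1_ge_sqr v j 0.
have := sqr_ge0 (`|v i 0| - `|v j 0|); rewrite sqrrB !real_normK ?num_real //.
lra.
Qed.

Lemma entry_sum_ge0 A : 0 <= entry_sum A.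
Proof. by do 2!(apply: sumr_ge0 => ? _). Qed.

(* [h (h A - A^2) = A (h - A) A + (h - A) A (h - A)] *)
Lemma qf_sqr_le k A h (X : 'M[K]_(m, k)) : A^T = A -> 0 < h ->
  (forall v : 'cV[K]_m, 0 <= qf A v) ->
  (forall v : 'cV[K]_m, qf A v <= h * qf 1%:M v) ->
  qf 1%:M (A *m X) <= h * qf A X.
Proof.
move=> At h0 A0 Ah.
have Bt : (h%:M - A)^T = h%:M - A by rewrite linearB /= tr_scalar_mx At.
have h1 : 0 <= qf (h%:M - A) (A *m X).
  by apply: qf_ge0 => v; rewrite qfB qf_scalar subr_ge0.
have h2 : 0 <= qf A ((h%:M - A) *m X) by exact: qf_ge0.
have : 0 <= h * (h * qf A X - qf 1%:M (A *m X)).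
  apply: le_trans (addr_ge0 h1 h2) _.
  rewrite !qf_mulmx At Bt mulmx1 -qfZ -qfB -qfZ -qfD le_eqVlt; apply/orP; left.
  apply/eqP; congr (qf _ X).
  rewrite !mulmxBl !mulmxBr !mulmxBl !mul_scalar_mx !mul_mx_scalar -!scalemxAl.
  move: (A *m A) (A *m A *m A) => A2 A3.
  by apply/matrixP => i j; rewrite !mxE; ring.
by rewrite pmulr_rge0 // subr_ge0.
Qed.

(** With b the form of the inverse at v, expanding the form of [A] at v - k^-1 A^-1 v gives 0 <= qf
    A v - 2 k^-1 |v|^2 + k^-2 b, and b <= k |v|^2. This replaces a compactness argument. *)
Lemma qf_unitmx_gt A : A^T = A -> A \in unitmx ->
  (forall v : 'cV[K]_m, 0 <= qf A v) ->
  exists2 c, 0 < c & forall v : 'cV[K]_m, c * qf 1%:M v <= qf A v.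
Proof.
move=> At Au A0; pose k := 1 + entry_sum (invmx A).
have k0 : 0 < k by rewrite ltr_pwDl ?ltr01 ?entry_sum_ge0.
exists k^-1; first by rewrite invr_gt0.
move=> v.
have := A0 (v + - (k^-1) *: (invmx A *m v)).
rewrite qfDr // qfZr qf_mulmx trmx_inv At.
rewrite mulVmx // mul1mx -scalemxAr mxtraceZ !mulmxA mulmxK // -qf1E sqrrN.
have := le_trans (ler_norm _) (qf_le_entry_sum (invmx A) v).
have -> : entry_sum (invmx A) = k - 1 by rewrite /k addrC addKr.
set a := qf 1%:M v; set b := qf (invmx A) v; move=> hb.
have a0 : 0 <= a := qf1_ge0 v.
have h2 : k^-1 ^+ 2 * b <= k^-1 * a.
  rewrite expr2 -mulrA ler_pM2l ?invr_gt0 // ler_pdivrMl //.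
  by apply: le_trans hb _; rewrite ler_wpM2r // lerBlDr lerDl.
lra.
Qed.

End QuadraticForm.

Lemma qf1_le_entry_sum (K : realFieldType) m l (B : 'M[K]_(l, m)) (v : 'cV[K]_m) :
  qf 1%:M (B *m v) <= entry_sum (B^T *m B) * qf 1%:M v.
Proof.
rewrite qf_mulmx mulmx1; exact: le_trans (ler_norm _) (qf_le_entry_sum _ _).
Qed.

(** The eigenvalue is the supremum a of all lower bounds of the Rayleigh quotient. If A - a were
    invertible, [qf_unitmx_gt] would make it coercive, and a + c would be a larger lower bound. *)
Lemma symmetric_min_eigenvalue (K : realType) m (A : 'M[K]_m.+1) : A^T = A ->
  exists2 a, eigenvalue A a &
    forall v : 'cV[K]_m.+1, a * qf 1%:M v <= qf A v.
Proof.
move=> At.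
pose S := [set a | forall v : 'cV[K]_m.+1, a * qf 1%:M v <= qf A v]%classic.
have Sne : (S !=set0)%classic.
  exists (- entry_sum A) => v; rewrite mulNr lerNl.
  by apply: le_trans (ler_norm _) _; rewrite normrN qf_le_entry_sum.
have e0 : (delta_mx 0 0 : 'cV[K]_m.+1) != 0.
  apply/eqP => /matrixP/(_ 0 0); rewrite !mxE !eqxx => /eqP.
  by rewrite oner_eq0.
have Sub : has_ubound S.
  exists (qf A (delta_mx 0 0 : 'cV_m.+1) / qf 1%:M (delta_mx 0 0 : 'cV[K]_m.+1)).
  by move=> a Sa; rewrite ler_pdivlMr ?qf1_gt0.
have Ssup : S (sup S).
  move=> v; have [->|v0] := eqVneq v 0.
    by rewrite /qf trmx0 !mul0mx mxtrace0 mulr0.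
  rewrite -ler_pdivlMr ?qf1_gt0 //; apply: ge_sup => // a Sa.
  by rewrite ler_pdivlMr ?qf1_gt0.
exists (sup S); last exact: Ssup.
rewrite /eigenvalue /eigenspace kermx_eq0 row_free_unit; apply/negP => uA.
have [||c c0 hc] := qf_unitmx_gt _ uA.
- by rewrite linearB /= tr_scalar_mx At.
- by move=> v; rewrite qfB qf_scalar subr_ge0.
have : S (sup S + c).
  by move=> v; rewrite mulrDl -lerBrDl; have := hc v;
    rewrite qfB (qf_scalar (sup S)).
by move=> Sc; have := ub_le_sup Sub Sc; rewrite gerDl leNgt c0.
Qed.

(** * Euclidean norm, operator norm and singular values *)

Lemma vnorm_sqr m (v : 'cV[R]_m) : vnorm v ^+ 2 = qf 1%:M v.
Proof.
rewrite qf1_sum big_ord1 sqr_sqrtr //.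
by apply: sumr_ge0 => i _; rewrite sqr_ge0.
Qed.

Lemma vnorm_ge0 m (v : 'cV[R]_m) : 0 <= vnorm v.
Proof. exact: sqrtr_ge0. Qed.

Lemma vnorm_gt0 m (v : 'cV[R]_m) : v != 0 -> 0 < vnorm v.
Proof.
move=> v0; rewrite lt_def vnorm_ge0 andbT -sqrf_eq0 vnorm_sqr.
by rewrite gt_eqF ?qf1_gt0.
Qed.

Lemma vnormZ m (a : R) (v : 'cV[R]_m) : vnorm (a *: v) = `|a| * vnorm v.
Proof.
apply/eqP; rewrite -(@eqrXn2 _ 2) ?mulr_ge0 ?vnorm_ge0 //.
by rewrite exprMn !vnorm_sqr qfZr real_normK ?num_real.
Qed.

Lemma vnorm0 m : vnorm (0 : 'cV[R]_m) = 0.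
Proof. by rewrite -(scale0r (0 : 'cV[R]_m)) vnormZ normr0 mul0r. Qed.

Lemma opnorm_ubound m k (A : 'M[R]_(m, k)) :
  has_ubound [set vnorm (A *m v) | v in [set v : 'cV[R]_k | vnorm v <= 1]]%classic.
Proof.
(* With K the entry sum, K <= (1 + K)^2, so 1 + K bounds the norm without a square root. *)
exists (1 + entry_sum (A^T *m A)) => _ [v /= v1 <-].
have K0 := entry_sum_ge0 (A^T *m A).
rewrite -(@ler_pXn2r _ 2) ?nnegrE ?vnorm_ge0 ?addr_ge0 // vnorm_sqr.
apply: le_trans (qf1_le_entry_sum _ _) _.
have : qf 1%:M v <= 1 by rewrite -vnorm_sqr expr_le1 ?vnorm_ge0.
by move/(ler_wpM2l K0); nra.
Qed.

Lemma opnorm_ge0 m k (A : 'M[R]_(m, k)) : 0 <= opnorm A.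
Proof.
apply: (@ub_le_sup _ _ (opnorm_ubound A)); exists 0 => /=.
  by rewrite vnorm0.
by rewrite mulmx0 vnorm0.
Qed.

Lemma vnorm_mulmx_le m k (A : 'M[R]_(m, k)) (v : 'cV[R]_k) :
  vnorm (A *m v) <= opnorm A * vnorm v.
Proof.
have [->|v0] := eqVneq v 0; first by rewrite mulmx0 !vnorm0 mulr0.
have n0 := vnorm_gt0 v0.
rewrite -ler_pdivrMr // mulrC.
have -> : (vnorm v)^-1 * vnorm (A *m v) = vnorm (A *m ((vnorm v)^-1 *: v)).
  by rewrite -scalemxAr vnormZ gtr0_norm ?invr_gt0.
apply: (@ub_le_sup _ _ (opnorm_ubound A)); exists ((vnorm v)^-1 *: v) => //=.
by rewrite vnormZ gtr0_norm ?invr_gt0 // mulVf ?gt_eqF.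
Qed.

Lemma qf1_mulmx_le m k l (A : 'M[R]_(m, k)) (X : 'M[R]_(k, l)) :
  qf 1%:M (A *m X) <= opnorm A ^+ 2 * qf 1%:M X.
Proof.
rewrite !(qf_cols 1%:M) mulr_sumr; apply: ler_sum => j _.
rewrite colE -mulmxA -colE -!vnorm_sqr -exprMn.
by rewrite ler_pXn2r ?nnegrE ?mulr_ge0 ?vnorm_ge0 ?opnorm_ge0 ?vnorm_mulmx_le.
Qed.

Lemma psdP m (A : 'M[R]_m) :
  psd A <-> A^T = A /\ forall v : 'cV[R]_m, 0 <= qf A v.
Proof.
by split=> -[At A0]; split=> // v; have := A0 v; rewrite qf_cV.
Qed.

(** Expanding |v - A v|^2 >= 0 and using |A v| <= |v| gives 2 qf A v <= 2 |v|^2. *)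
Lemma Qbar_qf_le m (A : 'M[R]_m) (v : 'cV[R]_m) :
  Qbar A -> qf A v <= qf 1%:M v.
Proof.
move=> [/psdP [At A0] A1].
have := A0 (v - A *m v); have := A0 v.
have : qf 1%:M (A *m v) <= qf 1%:M v.
  apply: le_trans (qf1_mulmx_le _ _) _.
  by rewrite ler_piMl ?qf1_ge0 // expr_le1 ?opnorm_ge0.
have := qf1_ge0 (v - A *m v).
rewrite -scaleN1r !qfDr ?tr_scalar_mx // !qfZr.
rewrite mulmx1 -!scalemxAr !mulmxA !mxtraceZ.
rewrite -[\tr (v^T *m A *m v)]/(qf A v). lra.
Qed.

Lemma eigenvalue_singular_value m (A : 'M[R]_m) a :
  A^T = A -> 0 <= a -> eigenvalue A a -> singular_value A a.
Proof.
move=> At a0 /eigenvalueP[v vA v0]; split=> //; apply/eigenvalueP.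
by exists v => //; rewrite At mulmxA vA -scalemxAl vA scalerA.
Qed.

Lemma singular_values_ubound m k (A : 'M[R]_(m, k)) :
  has_ubound [set s | singular_value A s]%classic.
Proof.
exists (1 + entry_sum (A^T *m A)) => s [/= s0 /eigenvalueP[v vA v0]].
have K0 := entry_sum_ge0 (A^T *m A).
have w0 : 0 < qf 1%:M v^T.
  by apply: qf1_gt0; apply: contra v0 => /eqP h; rewrite -(trmxK v) h trmx0.
have : s ^+ 2 * qf 1%:M v^T <= entry_sum (A^T *m A) * qf 1%:M v^T.
  apply: le_trans (qf_le_entry_sum _ _).
  by rewrite /qf trmxK vA -scalemxAl mxtraceZ mulmx1 ler_norm.
rewrite ler_pM2r // => h.
rewrite -(@ler_pXn2r _ 2) ?nnegrE ?addr_ge0 //; nra.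
Qed.

Lemma psd_eigenvalue_ge0 m (A : 'M[R]_m) a :
  (forall v : 'cV[R]_m, 0 <= qf A v) -> eigenvalue A a -> 0 <= a.
Proof.
move=> A0 /eigenvalueP[w wA w0].
have := A0 w^T; rewrite /qf trmxK wA -scalemxAl mxtraceZ.
rewrite -[w in \tr(w *m _)]trmxK -qf1E pmulr_lge0 // qf1_gt0 //.
by apply: contra w0 => /eqP h; rewrite -(trmxK w) h trmx0.
Qed.

(** The least eigenvalue of a psd matrix is one of its singular values, so the infimum lies below
    it. Dimension 0 has no eigenvalue, but there both sides vanish. *)
Lemma sigma_min_qf_le m (A : 'M[R]_m) (v : 'cV[R]_m) :
  psd A -> sigma_min A * qf 1%:M v <= qf A v.
Proof.
case: m => [|m] in A v *.
  by move=> _; rewrite !(qf_cV, mxE) !big_ord0 mulr0.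
move=> /psdP[At A0]; have [a ea ha] := symmetric_min_eigenvalue At.
have a0 : 0 <= a := psd_eigenvalue_ge0 A0 ea.
apply: le_trans (ha v); rewrite ler_wpM2r ?qf1_ge0 //.
apply: ge_inf; first by exists 0 => s [].
exact: eigenvalue_singular_value.
Qed.

Lemma qf_le_sigma_max m (A : 'M[R]_m) (v : 'cV[R]_m) :
  psd A -> qf A v <= sigma_max A * qf 1%:M v.
Proof.
case: m => [|m] in A v *.
  by move=> _; rewrite !(qf_cV, mxE) !big_ord0 mulr0.
move=> /psdP[At A0].
(* The largest eigenvalue of [A] is minus the least one of [- A]. *)
have [|a ea ha] := @symmetric_min_eigenvalue _ _ (- A).
  by rewrite linearN /= At.
have /eigenvalueP[w wA w0] := ea.
have ea' : eigenvalue A (- a).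
  by apply/eigenvalueP; exists w; rewrite // scaleNr -wA mulmxN opprK.
have := ha v; rewrite qfN lerNr -mulNr => /le_trans; apply.
rewrite ler_wpM2r ?qf1_ge0 //.
apply: (ub_le_sup (singular_values_ubound A)).
exact: eigenvalue_singular_value (psd_eigenvalue_ge0 A0 ea') ea'.
Qed.

(** * Monotonicity from increments, and the calculus of remainders *)

(* Halving [a, b] repeatedly divides the bound [C (b - a)^2] by 2 each time. *)
Lemma quadratic_increment_le (K : archiRealFieldType) (f : K -> K) a b C :
  a <= b ->
  (forall s t, a <= s -> s < t -> t <= b -> f t - f s <= C * (t - s) ^+ 2) ->
  f b <= f a.
Proof.
move=> ab hf.
have halve k s t : a <= s -> s < t -> t <= b ->
    f t - f s <= C * (t - s) ^+ 2 / 2 ^+ k.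
  elim: k s t => [|k IH] s t s1 st t1; first by rewrite expr0 divr1; exact: hf.
  have [sm mt] := midf_lt st; set m := (s + t) / 2 in sm mt.
  have := IH s m s1 sm (le_trans (ltW mt) t1).
  have := IH m t (le_trans s1 (ltW sm)) mt t1.
  have -> : m - s = (t - s) / 2 by rewrite /m; field.
  have -> : t - m = (t - s) / 2 by rewrite /m; field.
  have k0 : (2 ^+ k : K) != 0 by rewrite expf_neq0 ?pnatr_eq0.
  have -> : C * ((t - s) / 2) ^+ 2 / 2 ^+ k = C * (t - s) ^+ 2 / 2 ^+ k.+1 / 2.
    by rewrite [2 ^+ k.+1]exprS; move: (2 ^+ k) k0 => q q0; field.
  lra.
have [<-//|nab] := eqVneq a b.
have {}ab : a < b by rewrite lt_neqAle nab.
rewrite -subr_le0 leNgt; apply/negP => d0.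
(* If f b > f a, this many halvings push the bound on f b - f a below f b - f a itself. *)
have := halve (Num.bound (C * (b - a) ^+ 2 / (f b - f a))) a b (lexx a) ab (lexx b).
have := upper_nthrootP (leqnn (Num.bound (C * (b - a) ^+ 2 / (f b - f a)))).
rewrite ltr_pdivrMr // [_ * (f b - f a)]mulrC -ltr_pdivrMr ?exprn_gt0 //.
by rewrite ltNge => /negP.
Qed.

Section Increments.
Variables (K : realFieldType) (T : K).
Implicit Types (f g : K -> K -> K) (k l : nat).

(** The relation f s t = O((t - s)^k), uniform on [0, T]; order 0 means bounded. *)
Definition incO k f := exists C, forall s t, 0 <= s -> s <= t -> t <= T ->
  `|f s t| <= C * (t - s) ^+ k.

Lemma incO_ge0 k f : incO k f -> exists2 C, 0 <= C &
  forall s t, 0 <= s -> s <= t -> t <= T -> `|f s t| <= C * (t - s) ^+ k.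
Proof.
move=> [C hC]; exists `|C| => // s t s0 st tT.
apply: le_trans (hC _ _ s0 st tT) _; rewrite ler_wpM2r ?ler_norm //.
by rewrite exprn_ge0 // subr_ge0.
Qed.

Lemma incO_ext k f g : (forall s t, f s t = g s t) -> incO k f -> incO k g.
Proof. by move=> fg [C hC]; exists C => s t *; rewrite -fg hC. Qed.

Lemma incO_cst c : incO 0 (fun _ _ => c).
Proof. by exists `|c| => s t *; rewrite expr0 mulr1. Qed.

Lemma incO0 k : incO k (fun _ _ => 0).
Proof. by exists 0 => s t *; rewrite normr0 mul0r. Qed.

Lemma incOD k f g : incO k f -> incO k g -> incO k (fun s t => f s t + g s t).
Proof.
move=> [C hC] [D hD]; exists (C + D) => s t s0 st tT.
by rewrite mulrDl (le_trans (ler_normD _ _)) // lerD ?hC ?hD.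
Qed.

Lemma incOM k l f g :
  incO k f -> incO l g -> incO (k + l) (fun s t => f s t * g s t).
Proof.
move=> [C hC] [D hD]; exists (C * D) => s t s0 st tT.
by rewrite exprD mulrACA normrM ler_pM ?hC ?hD.
Qed.

Lemma incO_sum (I : finType) k (F : I -> K -> K -> K) :
  (forall i, incO k (F i)) -> incO k (fun s t => \sum_i F i s t).
Proof.
move=> hF; elim: (index_enum I) => [|i r IH].
  by apply: incO_ext (incO0 k) => s t; rewrite big_nil.
by apply: incO_ext (incOD (hF i) IH) => s t; rewrite big_cons.
Qed.

Lemma incO_le k l f : (l <= k)%N -> incO k f -> incO l f.
Proof.
move=> lk /incO_ge0[C C0 hC]; exists (C * T ^+ (k - l)) => s t s0 st tT.
apply: le_trans (hC _ _ s0 st tT) _.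
rewrite -{1}(subnK lk) exprD -mulrA ler_wpM2l // ler_wpM2r ?exprn_ge0 ?subr_ge0 //.
have T0 := le_trans s0 (le_trans st tT).
by rewrite lerXn2r ?nnegrE ?subr_ge0 // lerBlDr ler_wpDr.
Qed.

Definition mxO {m n} k (A : K -> K -> 'M[K]_(m, n)) :=
  forall i j, incO k (fun s t => A s t i j).

Lemma mxO_cst m n (A : 'M[K]_(m, n)) : mxO 0 (fun _ _ => A).
Proof. by move=> i j; exact: incO_cst. Qed.

Lemma mxOD m n k (A B : K -> K -> 'M[K]_(m, n)) :
  mxO k A -> mxO k B -> mxO k (fun s t => A s t + B s t).
Proof.
by move=> hA hB i j; apply: incO_ext (incOD (hA i j) (hB i j)) => s t; rewrite mxE.
Qed.

Lemma mxOM m n q k l (A : K -> K -> 'M[K]_(m, n)) (B : K -> K -> 'M[K]_(n, q)) :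
  mxO k A -> mxO l B -> mxO (k + l) (fun s t => A s t *m B s t).
Proof.
move=> hA hB i j.
apply: incO_ext (incO_sum (fun u => incOM (hA i u) (hB u j))) => s t.
by rewrite mxE.
Qed.

Lemma mxO_tr m n k (A : K -> K -> 'M[K]_(m, n)) :
  mxO k A -> mxO k (fun s t => (A s t)^T).
Proof. by move=> hA i j; apply: incO_ext (hA j i) => s t; rewrite mxE. Qed.

Lemma incO_trace m k (A : K -> K -> 'M[K]_m) :
  mxO k A -> incO k (fun s t => \tr (A s t)).
Proof. by move=> hA; exact: incO_sum (fun i => hA i i). Qed.

Lemma mxO_le m n k l (A : K -> K -> 'M[K]_(m, n)) :
  (l <= k)%N -> mxO k A -> mxO l A.
Proof. by move=> lk hA i j; exact: incO_le lk (hA i j). Qed.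

End Increments.

(** Plays the role of the rule that a nonpositive derivative makes a function nonincreasing. *)
Lemma incO2_le (K : archiRealFieldType) (T : K) (f : K -> K) e :
  incO T 2 e ->
  (forall s t, 0 <= s -> s < t -> t <= T -> f t - f s <= e s t) ->
  forall s t, 0 <= s -> s <= t -> t <= T -> f t <= f s.
Proof.
move=> [C hC] hf s t s0 st tT; apply: (@quadratic_increment_le _ f s t C) => //.
move=> u v su uv vt; have u0 := le_trans s0 su; have vT := le_trans vt tT.
apply: le_trans (hf _ _ u0 uv vT) _.
by apply: le_trans (ler_norm _) _; apply: hC => //; exact: ltW.
Qed.

(** Expand the form at c X - Y, which is nonnegative, and divide by c. *)
Lemma qf_young (K : realFieldType) m k (A : 'M[K]_m) (X Y : 'M[K]_(m, k)) c :
  A^T = A -> (forall v : 'cV[K]_m, 0 <= qf A v) -> 0 < c ->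
  2 * \tr (X^T *m A *m Y) <= c * qf A X + c^-1 * qf A Y.
Proof.
move=> At A0 c0.
have : 0 <= qf A (c *: X + (-1) *: Y) by exact: qf_ge0.
rewrite qfDr // !qfZr -scalemxAr mxtraceZ sqrrN expr1n mul1r.
rewrite [(c *: X)^T]linearZ /= -!scalemxAl mxtraceZ.
set x := qf A X; set y := qf A Y; set z := \tr _ => h.
rewrite -(ler_pM2l c0) mulrDr mulVKf ?gt_eqF //; nra.
Qed.

(** * Dissipation estimate, with [P s t] standing for the integral of [Q] over [s, t] *)

Section Dissipation.
Variables (K : archiRealFieldType) (p n : nat) (T g : K).
Variables (G Om : 'M[K]_p) (Y : K -> 'M[K]_(p, n)) (P : K -> K -> 'M[K]_n).
Hypotheses (T0 : 0 < T) (g0 : 0 < g) (OmT : Om^T = Om).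
Hypothesis (Gg : forall X : 'M[K]_(p, n), qf 1%:M (G *m X) <= g ^+ 2 * qf 1%:M X).
Hypothesis (PT : forall s t, 0 <= s -> s <= t -> t <= T -> (P s t)^T = P s t).
Hypothesis (P0 : forall s t (v : 'cV[K]_n), 0 <= s -> s <= t -> t <= T ->
  0 <= qf (P s t) v).
Hypothesis (P1 : forall s t (v : 'cV[K]_n), 0 <= s -> s <= t -> t <= T ->
  qf (P s t) v <= (t - s) * qf 1%:M v).
Hypothesis (PD : forall s t, 0 <= s -> s <= t -> t <= T -> P 0 t = P 0 s + P s t).
Hypotheses (YO : mxO T 0 (fun s _ => Y s)) (PO : mxO T 1 P).
Hypothesis (EO : mxO T 2 (fun s t => Y t - Y s - G *m Y s *m P s t)).
Hypothesis (lyap : forall s t, 0 <= s -> s <= t -> t <= T ->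
  2 * \tr ((Y s)^T *m Om *m (G *m Y s *m P s t)) = - qf (P s t) (Y s)^T).

Let D t := qf Om (Y 0) - qf Om (Y t).
Let E s t := Y t - Y s - G *m Y s *m P s t.
Let e s t := D t - D s - qf (P s t) (Y s)^T.

(** Discrete form of dD/dt = tr (Y Q Y^T). Expanding [qf Om] around [Y s], the linear term along G Y
    P is given by [lyap]; what remains is linear in [E] or quadratic in Y t - Y s, hence of order
    2. *)
Let eO : incO T 2 e.
Proof.
have YtO : mxO T 1 (fun s t => G *m Y s *m P s t).
  exact: mxOM (mxOM (mxO_cst T G) YO) PO.
have DO : mxO T 1 (fun s t => Y t - Y s).
  move=> i j; apply: incO_ext (mxOD YtO (mxO_le (isT : (1 <= 2)%N) EO) i j) => s t.
  by rewrite addrC subrK.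
have h1 := incO_trace (mxOM (mxOM (mxO_tr YO) (mxO_cst T Om)) EO).
have h2 := incO_trace (mxOM (mxOM (mxO_tr DO) (mxO_cst T Om)) DO).
move: (incOD h1 (incOD h1 h2)) => [C hC]; exists C => s t s0 st tT.
apply: le_trans _ (hC s t s0 st tT).
rewrite -normrN le_eqVlt; apply/orP; left; apply/eqP; congr `|_|.
rewrite /e /D.
have -> : Y t = Y s + (Y t - Y s) by rewrite addrC subrK.
rewrite qfDr // [Y s + _ - _]addrC addKr.
have {1}-> : Y t - Y s = G *m Y s *m P s t + E s t by rewrite [RHS]addrC subrK.
rewrite mulmxDr mxtraceD mulrDr lyap // -/(qf Om (Y t - Y s)) /E.
ring.
Qed.

Let D0 : D 0 = 0. Proof. by rewrite /D subrr. Qed.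

Let D_le s t : 0 <= s -> s <= t -> t <= T -> D s <= D t.
Proof.
move=> s0 st tT; rewrite -lerN2.
have e'O : incO T 2 (fun s t => - e s t).
  by case: eO => C hC; exists C => *; rewrite normrN hC.
apply: (incO2_le (f := fun t => - D t) e'O) => // a b a0 ab bT.
have := qf_ge0 (Y a)^T (fun v => P0 v a0 (ltW ab) bT).
rewrite /e; lra.
Qed.

(** Pairing with the fixed final displacement W avoids Cauchy-Schwarz for integrals: Young bounds
    the derivative of 2 tr (W^T Y) by c |W|^2 + (g^2 / c) dD/dt, and integrating over [0, t] gives 2
    |W|^2 <= c t |W|^2 + (g^2 / c) D t. *)
Let drift t : 0 <= t -> t <= T ->
  qf 1%:M (Y t - Y 0) <= g ^+ 2 * T * D T.
Proof.
move=> t0 tT; set W := Y t - Y 0.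
(* This c gives c t <= 1, so the term in |W|^2 is absorbed on the left. *)
pose c := T^-1; have c0 : 0 < c by rewrite invr_gt0.
pose f t := 2 * \tr (W^T *m Y t) - c * t * qf 1%:M W - g ^+ 2 / c * D t.
have h1 := incO_trace (mxOM (mxO_tr (mxO_cst T W)) EO).
have h2 := incOM (incO_cst T (- (g ^+ 2 / c))) eO.
have hO := incOD (incOD h1 h1) h2.
have : f t <= f 0.
  apply: (incO2_le hO) => // a b a0 ab bT.
  have -> : Y b = Y a + G *m Y a *m P a b + E a b.
    by rewrite /E -addrA [_ *m P a b + _]addrC subrK [RHS]addrC subrK.
  have h0 : 0 < b - a by rewrite subr_gt0.
  (* The weight is proportional to b - a so that both Young terms are of first order: the squared
     norm of Y P is at most (b - a) times the dissipation, by [qf_sqr_le]. *)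
  have := @qf_young _ _ _ 1%:M W (G *m Y a *m P a b) (c * (b - a)).
  rewrite tr_scalar_mx mulmx1 => /(_ erefl (fun v => qf1_ge0 v) (mulr_gt0 c0 h0)).
  have : (c * (b - a))^-1 * qf 1%:M (G *m Y a *m P a b)
           <= g ^+ 2 / c * qf (P a b) (Y a)^T.
    rewrite -mulmxA; apply: (@le_trans _ _ ((c * (b - a))^-1 * (g ^+ 2 *
      ((b - a) * qf (P a b) (Y a)^T)))).
      rewrite ler_pM2l ?invr_gt0 ?mulr_gt0 //; apply: le_trans (Gg _) _.
      rewrite ler_wpM2l ?sqr_ge0 //.
      have -> : qf 1%:M (Y a *m P a b) = qf 1%:M (P a b *m (Y a)^T).
        rewrite !qf1E -mxtrace_tr trmx_mul trmxK mxtrace_mulC !trmx_mul !trmxK.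
        by rewrite PT // ltW.
      apply: qf_sqr_le => // [|v|v]; rewrite ?PT ?P0 ?P1 //; exact: ltW.
    rewrite invfM le_eqVlt; apply/orP; left; apply/eqP; field.
    by rewrite !gt_eqF.
  rewrite /f /e !mulmxDr !mxtraceD /E.
  set x := \tr _; set y := \tr _; set z := \tr _; set w := qf 1%:M W.
  set q := qf 1%:M (_ *m _); set u := qf _ _.
  set gc := g ^+ 2 / c.
  nra.
rewrite /f D0 !mulr0 mul0r !subr0.
have -> : \tr (W^T *m Y t) = qf 1%:M W + \tr (W^T *m Y 0).
  by rewrite qf1E -mxtraceD -mulmxDr subrK.
have w0 := qf1_ge0 W.
have : c * t * qf 1%:M W <= qf 1%:M W.
  by rewrite ler_piMl // /c mulrC ler_pdivrMr // mul1r.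
have : g ^+ 2 / c * D t <= g ^+ 2 * T * D T.
  rewrite /c invrK ler_wpM2l ?D_le ?mulr_ge0 ?sqr_ge0 // ltW //.
lra.
Qed.

(** The triangle inequality is used in Young form: splitting Z = Y a + (Z - Y a) with weight mu
    costs (1 + mu) times the dissipation plus (1 + mu^-1) times the drift term. For mu = g T the
    total is (1 + mu) D + (1 + mu^-1) mu^2 D = (1 + mu)^2 D. *)
Lemma dissipation_ge :
  qf (P 0 T) (Y 0)^T <= (1 + g * T) ^+ 2 * (qf Om (Y 0) - qf Om (Y T)).
Proof.
rewrite -/(D T); set Z := Y 0; pose mu := g * T.
have mu0 : 0 < mu by rewrite mulr_gt0.
pose c := (1 + mu^-1) * (g ^+ 2 * T * D T).
pose f t := qf (P 0 t) Z^T - (1 + mu) * D t - c * t.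
have hO := incOM (incO_cst T (- (1 + mu))) eO.
have : f T <= f 0.
  apply: (incO2_le hO) => //; last exact: ltW.
  move=> a b a0 ab bT; have ab' := ltW ab.
  have := drift a0 (le_trans ab' bT); rewrite -/Z => hd.
  rewrite /f (PD a0 ab' bT) qfD.
  have -> : Z^T = (Y a)^T + (Z - Y a)^T by rewrite -linearD /= addrC subrK.
  have h1 := qf_young (Y a)^T (Z - Y a)^T (PT a0 ab' bT)
    (fun v => P0 v a0 ab' bT) mu0.
  have h2 : qf (P a b) (Z - Y a)^T <= (b - a) * (g ^+ 2 * T * D T).
    apply: (@le_trans _ _ ((b - a) * qf 1%:M (Z - Y a)^T)).
      rewrite -qf_scalar -subr_ge0 -qfB; apply: qf_ge0 => v.
      by rewrite qfB qf_scalar subr_ge0 P1.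
    rewrite ler_wpM2l ?subr_ge0 //; apply: le_trans hd.
    have -> : Z - Y a = -1 *: (Y a - Z) by rewrite scaleN1r opprB.
    by rewrite linearZ /= qfZr sqrrN expr1n mul1r !qf1E trmxK mxtrace_mulC.
  have mi0 : 0 < 1 + mu^-1 by rewrite addr_gt0 ?invr_gt0.
  move: h1 (ler_wpM2l (ltW mi0) h2).
  rewrite (qfDr _ _ (PT a0 ab' bT)) /e /c.
  set tr2 := \tr _.
  set x := qf (P 0 a) _; set y := qf (P a b) (Y a)^T; set z := qf (P a b) _.
  lra.
rewrite /f D0 !mulr0 !subr0 => h.
have : qf (P 0 0) Z^T <= 0.
  rewrite -oppr_ge0 -qfN; apply: qf_ge0 => v; rewrite qfN oppr_ge0.
  by have := @P1 0 0 v (lexx _) (lexx _) (ltW T0); rewrite subrr mul0r.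
move=> h0; have := le_trans h h0.
have -> : c * T = (1 + g * T) * (g * T) * D T.
  by rewrite /c /mu; field; rewrite !gt_eqF.
rewrite /mu; lra.
Qed.

End Dissipation.

(** * Riemann integrals of real functions *)

Section RiemannIntegral.
Implicit Types (f g : R -> R) (a b s t : R).

Lemma is_RIntB f g a b (k l : R) :
  is_RInt f a b k -> is_RInt g a b l -> is_RInt (fun u => f u - g u) a b (k - l).
Proof. by move=> hf hg; apply: (is_RInt_minus _ _ _ _ _ _ hf hg). Qed.

Lemma is_RInt_linear (I : finType) (c : I -> R) (f : I -> R -> R) a b (l : I -> R) :
  (forall i, is_RInt (f i) a b (l i)) ->
  is_RInt (fun u => \sum_i c i * f i u) a b (\sum_i c i * l i).
Proof.
move=> hf; elim: (index_enum I) => [|i r IH].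
  rewrite big_nil; apply: (is_RInt_ext (fun=> 0 : R)) => [u _|].
    by rewrite big_nil.
  by have := is_RInt_const a b (0 : R); rewrite /scal /= /mult /= RmultE mulr0.
rewrite big_cons.
apply: (is_RInt_ext (fun u => c i * f i u + \sum_(i <- r) c i * f i u)) => [u _|].
  by rewrite big_cons.
by apply: (is_RInt_plus _ _ _ _ _ _ (is_RInt_scal _ _ _ _ _ (hf i)) IH).
Qed.

Lemma eq_is_RInt f g a b (l : R) : a <= b ->
  (forall u, a <= u -> u <= b -> f u = g u) -> is_RInt f a b l -> is_RInt g a b l.
Proof.
move=> /RleP ab fg; apply: is_RInt_ext => u.
rewrite Rmin_left // Rmax_right // => -[/Rlt_le/RleP au /Rlt_le/RleP ub].
exact: fg.
Qed.

Lemma is_RInt_increment f (F : R -> R) :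
  (forall t, 0 <= t -> is_RInt f 0 t (F t - F 0)) ->
  forall s t, 0 <= s -> 0 <= t -> is_RInt f s t (F t - F s).
Proof.
move=> hF s t s0 t0.
have -> : F t - F s = - (F s - F 0) + (F t - F 0) by ring.
exact: (is_RInt_Chasles _ _ _ _ _ _ (is_RInt_swap _ _ _ _ (hF s s0)) (hF t t0)).
Qed.

Lemma is_RInt_norm_le f a b (l M : R) : a <= b ->
  (forall u, a <= u -> u <= b -> `|f u| <= M) -> is_RInt f a b l ->
  `|l| <= M * (b - a).
Proof.
move=> /RleP ab hM hf; rewrite mulrC -RabsE; apply/RleP.
apply: (norm_RInt_le_const f a b l M ab _ hf) => u [/RleP au /RleP ub].
by apply/RleP; rewrite /norm /= /abs /= RabsE hM.
Qed.

Lemma is_RInt_mono f g a b (k l : R) : a <= b ->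
  (forall u, a <= u -> u <= b -> f u <= g u) ->
  is_RInt f a b k -> is_RInt g a b l -> k <= l.
Proof.
move=> /RleP ab fg hf hg; apply/RleP; apply: (is_RInt_le f g a b k l ab hf hg).
by move=> u [/Rlt_le/RleP au /Rlt_le/RleP ub]; apply/RleP/fg.
Qed.

Lemma is_RInt_cst a b c : is_RInt (fun=> c) a b ((b - a) * c).
Proof. exact: is_RInt_const. Qed.

Lemma ex_RInt_sub f s t b :
  ex_RInt f 0 b -> 0 <= s -> s <= t -> t <= b -> ex_RInt f s t.
Proof.
move=> hf /RleP s0 /RleP st /RleP tb.
apply: (ex_RInt_Chasles_2 f 0 s t); first by split.
by apply: (ex_RInt_Chasles_1 f 0 t b) => //; split=> //; exact: Rle_trans st.
Qed.

(** Riemann integrability forces boundedness, the source of the remainder bounds on trajectories. *)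
Lemma ex_RInt_bounded f T : 0 <= T -> ex_RInt f 0 T -> incO T 0 (fun _ t => f t).
Proof.
move=> /RleP T0 /ex_RInt_ub[M hM]; exists M => s t s0 st tT.
rewrite expr0 mulr1; apply/RleP; rewrite -RabsE; apply: hM.
rewrite Rmin_left // Rmax_right //; split; apply/RleP => //; exact: le_trans st.
Qed.

Lemma is_RInt_incO f (F : R -> R -> R) T : 0 <= T -> ex_RInt f 0 T ->
  (forall s t, 0 <= s -> s <= t -> t <= T -> is_RInt f s t (F s t)) ->
  incO T 1 F.
Proof.
move=> T0 /(ex_RInt_bounded T0)[C hC] hF; exists C => s t s0 st tT.
rewrite expr1; apply: is_RInt_norm_le (hF s t s0 st tT) => // u su ut.
have u0 := le_trans s0 su.
by have := hC u u u0 (lexx u) (le_trans ut tT); rewrite expr0 mulr1.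
Qed.

End RiemannIntegral.

(** * The integral of the matrix function [Q] *)

Section IntegralMatrix.
Variables (n : nat) (Q : R -> 'M[R]_n).
Hypotheses (Qint : riemann_int_mx Q) (Qb : forall t, 0 <= t -> Qbar (Q t)).

Lemma int_mxP s t i j : 0 <= s -> s <= t ->
  is_RInt (fun u => Q u i j) s t (int_mx Q s t i j).
Proof.
move=> s0 st; rewrite mxE; apply: RInt_correct.
exact: ex_RInt_sub (Qint i j (le_trans s0 st)) s0 st (lexx t).
Qed.

Lemma int_mx_mull m (A : 'M[R]_(m, n)) s t i j : 0 <= s -> s <= t ->
  is_RInt (fun u => (A *m Q u) i j) s t ((A *m int_mx Q s t) i j).
Proof.
move=> s0 st; rewrite mxE.
apply: (eq_is_RInt (f := fun u => \sum_k A i k * Q u k j)) => // [u _ _|].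
  by rewrite mxE.
by apply: is_RInt_linear => k; exact: int_mxP.
Qed.

Lemma int_mx_qf s t (v : 'cV[R]_n) : 0 <= s -> s <= t ->
  is_RInt (fun u => qf (Q u) v) s t (qf (int_mx Q s t) v).
Proof.
move=> s0 st.
have qfE A : qf A v = \sum_k v k 0 * (v^T *m A) 0 k.
  by rewrite qf_cV mxE; apply: eq_bigr => k _; rewrite mulrC.
rewrite qfE; apply: (eq_is_RInt st (fun u _ _ => esym (qfE (Q u)))).
by apply: is_RInt_linear => k; exact: int_mx_mull.
Qed.

Lemma int_mx_tr s t : 0 <= s -> s <= t -> (int_mx Q s t)^T = int_mx Q s t.
Proof.
move=> s0 st; apply/matrixP => i j; rewrite !mxE; apply: is_RInt_unique.
have := @int_mxP s t i j s0 st; rewrite mxE; apply: eq_is_RInt => // u su _.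
by have [[QT _] _] := Qb (le_trans s0 su); rewrite -{1}QT mxE.
Qed.

Lemma int_mx_qf_ge0 s t (v : 'cV[R]_n) : 0 <= s -> s <= t ->
  0 <= qf (int_mx Q s t) v.
Proof.
move=> s0 st; have := @is_RInt_cst s t 0; rewrite mulr0 => h0.
apply: (is_RInt_mono st _ h0 (@int_mx_qf s t v s0 st)) => u su _.
by have [/psdP[_ Q0] _] := Qb (le_trans s0 su).
Qed.

Lemma int_mx_qf_le s t (v : 'cV[R]_n) : 0 <= s -> s <= t ->
  qf (int_mx Q s t) v <= (t - s) * qf 1%:M v.
Proof.
move=> s0 st.
apply: (is_RInt_mono st _ (@int_mx_qf s t v s0 st) (@is_RInt_cst s t _)) => u su _.
exact: Qbar_qf_le (Qb (le_trans s0 su)).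
Qed.

Lemma int_mxD s t : 0 <= s -> s <= t ->
  int_mx Q 0 t = int_mx Q 0 s + int_mx Q s t.
Proof.
move=> s0 st; apply/matrixP => i j; rewrite !mxE; apply: is_RInt_unique.
have := @int_mxP 0 s i j (lexx 0) s0; have := @int_mxP s t i j s0 st.
rewrite !mxE => h2 h1.
exact: (is_RInt_Chasles _ _ _ _ _ _ h1 h2).
Qed.

Lemma int_mx_mxO T : 0 <= T -> mxO T 1 (int_mx Q).
Proof.
move=> T0 i j; apply: (is_RInt_incO T0 (Qint i j T0)) => s t s0 st _.
exact: int_mxP.
Qed.

End IntegralMatrix.

(** * Kronecker products acting on p x n matrices *)

Section Unvec.
Variables (p n : nat).

(** Row i is the state of node i, and A (x) B acts as X -> A X B^T. *)
Definition unvec (x : 'cV[R]_(p * n)) : 'M[R]_(p, n) :=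
  \matrix_(i, j) x (mxtens_index (i, j)) 0.

Lemma sum_mxtens (F : 'I_(p * n) -> R) :
  \sum_k F k = \sum_i \sum_j F (mxtens_index (i, j)).
Proof.
rewrite pair_bigA /= (reindex (@mxtens_index p n)) /=.
  by apply: eq_bigr => -[].
by exists (@mxtens_unindex p n) => k _; rewrite (mxtens_indexK, mxtens_unindexK).
Qed.

Lemma unvec_tens (A : 'M[R]_p) (B : 'M[R]_n) x :
  unvec ((A *t B) *m x) = A *m unvec x *m B^T.
Proof.
apply/matrixP => i j; rewrite !mxE sum_mxtens exchange_big /=.
apply: eq_bigr => l _; rewrite !mxE mulr_suml; apply: eq_bigr => k _.
by rewrite tensmxE !mxE mulrAC.
Qed.

Lemma unvecB x y : unvec (x - y) = unvec x - unvec y.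
Proof. by apply/matrixP => i j; rewrite !mxE. Qed.

Lemma Vfun_unvec (Om : 'M[R]_p) x : Vfun Om x = qf Om (unvec x).
Proof.
rewrite /Vfun /qf -!mulmxA mxtrace_mulC.
have -> : Om *m unvec x = unvec ((Om *t 1%:M) *m x).
  by rewrite unvec_tens trmx1 mulmx1.
rewrite mxE sum_mxtens; apply: eq_bigr => i _; rewrite !mxE.
by apply: eq_bigr => j _; rewrite !mxE mulrC.
Qed.

End Unvec.

(** * The numerical estimate behind the rate *)

Lemma delta_le (eps T g : R) : 0 < eps -> eps <= T -> 0 <= g ->
  delta eps T / Num.max 1 (g ^+ 3) * (1 + Num.max 1 g * T) ^+ 2 <= eps.
Proof.
move=> e0 eT g0; have T0 := lt_le_trans e0 eT.
have dT : delta eps T * (1 + T) ^+ 2 <= eps.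
  have d1 : delta eps T <= eps / 2 by rewrite ge_min lexx.
  have d2 : delta eps T <= eps / (240 * T ^+ 3).
    apply: (@le_trans _ _ (eps ^+ 3 / (240 * T ^+ 5))).
      by rewrite ge_min lexx orbT.
    rewrite ler_pdivrMr ?mulr_gt0 ?exprn_gt0 //.
    have -> : eps / (240 * T ^+ 3) * (240 * T ^+ 5) = eps * T ^+ 2.
      by field; rewrite gt_eqF.
    by rewrite exprS ler_pM2l // ler_pXn2r // nnegrE ltW.
  have s0 : 0 <= (1 + T) ^+ 2 := sqr_ge0 _.
  (* Up to 2/5, (1 + T)^2 <= 49/25 < 2 and the bound eps/2 suffices; beyond it, (1 + T)^2 <= 240
     T^3. *)
  have [Ts|Tl] := leP T (2 / 5).
    apply: le_trans (ler_wpM2r s0 d1) _.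
    rewrite -mulrA ler_piMr ?ltW //; nra.
  apply: le_trans (ler_wpM2r s0 d2) _.
  have t3 : 0 < T ^+ 3 by rewrite exprn_gt0.
  rewrite mulrAC ler_pdivrMr ?mulr_gt0 // ler_pM2l //.
  nra.
have [g1|g1] := leP g 1.
  have -> : Num.max 1 (g ^+ 3) = 1 by apply/max_idPl; rewrite expr_le1.
  by rewrite divr1 mul1r.
have -> : Num.max 1 (g ^+ 3) = g ^+ 3.
  by apply/max_idPr; rewrite expr_ge1 // ltW.
have d0 : 0 < delta eps T.
  by rewrite lt_min !divr_gt0 ?mulr_gt0 ?exprn_gt0.
have {}g0 : 0 < g := lt_trans ltr01 g1.
apply: le_trans dT; rewrite -mulrA ler_pM2l // mulrC ler_pdivrMr ?exprn_gt0 //.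
(* For g > 1 the factor g^2 gained here is absorbed by g^3. *)
have : (1 + g * T) ^+ 2 <= (g * (1 + T)) ^+ 2.
  rewrite ler_pXn2r ?nnegrE ?addr_ge0 ?mulr_ge0 ?addr_ge0 ?(ltW T0) ?(ltW g0) //.
  by rewrite mulrDr mulr1 lerD2r ltW.
move/le_trans; apply; rewrite exprMn mulrC ler_wpM2l ?sqr_ge0 //.
by rewrite ler_weXn2l // ltW.
Qed.

Lemma interconnection_ones p (G : 'M[R]_p) : interconnection G -> G *m ones p = 0.
Proof.
move=> [_ Gd]; apply/matrixP => i j; rewrite !mxE (bigD1 i) //= mxE mulr1 Gd.
rewrite addrC; apply/eqP; rewrite subr_eq0; apply/eqP.
by apply: eq_bigr => k _; rewrite mxE mulr1.
Qed.

(** * Regularity and conservation along solutions *)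

Section Solution.
Variables (p n : nat) (T : R) (G : 'M[R]_p) (Q : R -> 'M[R]_n).
Variable Y : R -> 'M[R]_(p, n).
Hypotheses (T0 : 0 <= T) (Qint : riemann_int_mx Q).
Hypothesis Ysol : forall i j s t, 0 <= s -> s <= t ->
  is_RInt (fun u => (G *m Y u *m Q u) i j) s t (Y t i j - Y s i j).

(** The integral equation itself makes G Y Q Riemann integrable, hence bounded. Boundedness of [Y]
    then follows from this. *)
Lemma solution_lipschitz : mxO T 1 (fun s t => Y t - Y s).
Proof.
move=> i j.
apply: (is_RInt_incO (f := fun u => (G *m Y u *m Q u) i j) T0) => [|s t s0 st _].
  by exists (Y T i j - Y 0 i j); exact: Ysol.
by rewrite !mxE; exact: Ysol.
Qed.

Lemma solution_bounded : mxO T 0 (fun s _ => Y s).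
Proof.
move=> i j; have [M M0 hM] := incO_ge0 (@solution_lipschitz i j).
exists (`|Y 0 i j| + M * T) => s t s0 st tT; rewrite expr0 mulr1.
have := hM 0 s (lexx 0) s0 (le_trans st tT); rewrite !mxE subr0 expr1 => h.
rewrite -[Y s i j](subrK (Y 0 i j)) addrC (le_trans (ler_normD _ _)) // lerD2l.
by apply: le_trans h _; rewrite ler_wpM2l // (le_trans st tT).
Qed.

(** The remainder is the integral over [s, t] of G (Y u - Y s) Q u, whose integrand is O(u - s). *)
Lemma solution_step :
  mxO T 2 (fun s t => Y t - Y s - G *m Y s *m int_mx Q s t).
Proof.
have QO : mxO T 0 (fun _ t => Q t).
  by move=> i j; exact: ex_RInt_bounded T0 (Qint i j T0).
move=> i j; have := mxOM (mxOM (mxO_cst T G) solution_lipschitz) QO i j.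
move=> /incO_ge0[C C0 hC]; exists C => s t s0 st tT.
have mxB (A B : 'M[R]_(p, n)) : A i j - B i j = (A - B) i j by rewrite !mxE.
have hs := @int_mx_mull n Q Qint p (G *m Y s) s t i j s0 st.
have := is_RIntB (@Ysol i j s t s0 st) hs; rewrite !mxB expr2 mulrA.
apply: (is_RInt_norm_le st) => u su ut; rewrite mxB -mulmxBl -mulmxBr.
have := hC s u s0 su (le_trans ut tT); rewrite expr1.
by move/le_trans; apply; rewrite ler_wpM2l // lerD2r.
Qed.

(** As r G = 0, the increments of r Y reduce to r applied to the second-order remainder, so both r Y
    and - r Y are nonincreasing. *)
Lemma solution_conservation k (r : 'M[R]_(k, p)) : r *m G = 0 ->
  forall t, 0 <= t -> t <= T -> r *m Y t = r *m Y 0.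
Proof.
move=> rG t t0 tT; apply/matrixP => i j.
have h1 := mxOM (mxO_cst T r) solution_step.
have h2 := mxOM (mxO_cst T (- r)) solution_step.
have inc (q : 'M[R]_(k, p)) s u : q *m G = 0 ->
    (q *m Y u) i j - (q *m Y s) i j
      = (q *m (Y u - Y s - G *m Y s *m int_mx Q s u)) i j.
  by move=> qG; rewrite !mulmxBr !mulmxA qG !mul0mx subr0 !mxE.
apply/eqP; rewrite eq_le; apply/andP; split.
  apply: (incO2_le (f := fun t => (r *m Y t) i j) (h1 i j)) => // s u _ _ _.
  by rewrite inc.
rewrite -lerN2.
have mxN s : - (r *m Y s) i j = (- r *m Y s) i j by rewrite mulNmx [RHS]mxE.
rewrite !mxN.
apply: (incO2_le (f := fun t => (- r *m Y t) i j) (h2 i j)) => // s u _ _ _.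
by rewrite inc // mulNmx rG oppr0.
Qed.

End Solution.

(** * The Lyapunov identity and the contraction estimate *)

(** Here [A] is G - 1 r^T, which agrees with [G] on matrices killed by r^T. Symmetry of [Om] and [P]
    makes the two cross terms have equal traces against [P]. *)
Lemma lyapunov_rate (K : comNzRingType) p n (Om G A : 'M[K]_p) (Y : 'M[K]_(p, n))
    (P : 'M[K]_n) :
  Om^T = Om -> P^T = P -> A^T *m Om + Om *m A = - 1%:M -> A *m Y = G *m Y ->
  2 * \tr (Y^T *m Om *m (G *m Y *m P)) = - qf P Y^T.
Proof.
move=> OmT PT lyap AY.
have h : (G *m Y)^T *m Om *m Y + Y^T *m Om *m (G *m Y) = - (Y^T *m Y).
  rewrite -AY trmx_mul -!mulmxA -mulmxDr !mulmxA -mulmxDl.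
  by rewrite mulmxA lyap mulmxN mulmx1 mulNmx.
have : \tr ((G *m Y)^T *m Om *m Y *m P) = \tr (Y^T *m Om *m (G *m Y *m P)).
  by rewrite -mxtrace_tr !trmx_mul !trmxK OmT PT mxtrace_mulC !mulmxA.
move=> e.
have -> : 2 * \tr (Y^T *m Om *m (G *m Y *m P))
    = \tr (((G *m Y)^T *m Om *m Y + Y^T *m Om *m (G *m Y)) *m P).
  by rewrite mulmxDl mxtraceD e mulr2n mulrDl mul1r !mulmxA.
by rewrite h mulNmx linearN /= /qf trmxK [in RHS]mxtrace_mulC mulmxA.
Qed.

Theorem theorem3 (p n : nat) (eps T : R) (G : 'M[R]_p) (r : 'cV[R]_p)
    (Om : 'M[R]_p) :
  0 < eps -> 0 < T ->
  connected_ic G ->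
  r^T *m G = 0 ->
  r^T *m ones p = 1 ->
  pd Om ->
  (G - ones p *m r^T)^T *m Om + Om *m (G - ones p *m r^T) = - 1%:M ->
  forall (Q : R -> 'M[R]_n) (x : R -> 'cV[R]_(p * n)),
    riemann_int_mx Q ->
    (forall t, 0 <= t -> Qbar (Q t)) ->
    sigma_min (int_mx Q 0 T) >= eps ->
    is_solution G Q x ->
    let xbar := ((ones p *m r^T) *t (1%:M : 'M[R]_n)) *m x 0 in
    Vfun Om (x T - xbar) <= (1 - delta eps T / rho G Om) * Vfun Om (x 0 - xbar).
Proof.
move=> eps0 T0 [/interconnection_ones G1 _] rG r1 [OmT Om0] lyap Q x Qint Qb.
move=> eps_le xsol; lazy zeta; set xbar := _ *m x 0; rewrite !Vfun_unvec.
have T0' := ltW T0.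
pose Y t := unvec (x t - xbar).
have YE t : Y t = unvec (x t) - ones p *m (r^T *m unvec (x 0)).
  by rewrite /Y unvecB /xbar unvec_tens trmx1 mulmx1 mulmxA.
(* [G] kills the all-ones vector, so the error obeys the same equation as [x]. *)
have GY t : G *m Y t = G *m unvec (x t).
  by rewrite YE mulmxBr !mulmxA G1 !mul0mx subr0.
have rY0 : r^T *m Y 0 = 0.
  by rewrite YE mulmxBr [r^T *m (ones p *m _)]mulmxA r1 mul1mx subrr.
have Ysol i j s t : 0 <= s -> s <= t ->
    is_RInt (fun u => (G *m Y u *m Q u) i j) s t (Y t i j - Y s i j).
  move=> s0 st.
  have hx := fun t => @xsol t (mxtens_index (i, j)).
  have := is_RInt_increment hx s0 (le_trans s0 st).
  have -> : x t (mxtens_index (i, j)) 0 - x s (mxtens_index (i, j)) 0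
            = Y t i j - Y s i j by rewrite !mxE; ring.
  apply: eq_is_RInt => // u su _; rewrite GY.
  have [[QT _] _] := Qb u (le_trans s0 su); rewrite -{2}QT -unvec_tens.
  by rewrite [RHS]mxE.
have PT s t (s0 : 0 <= s) (st : s <= t) := int_mx_tr Qint Qb s0 st.
have Om0' (v : 'cV[R]_p) : 0 <= qf Om v.
  have [->|v0] := eqVneq v 0; first by rewrite /qf mulmx0 mxtrace0.
  by rewrite qf_cV ltW // Om0.
set g := opnorm G; have g0 : 0 <= g := opnorm_ge0 G.
(* The maximum keeps the gain positive even when G = 0, as the division by mu = m T requires. *)
set m := Num.max 1 g; have m0 : 0 < m by rewrite lt_max ltr01.
have Gm (X : 'M[R]_(p, n)) : qf 1%:M (G *m X) <= m ^+ 2 * qf 1%:M X.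
  apply: le_trans (qf1_mulmx_le _ _) _; rewrite ler_wpM2r ?qf1_ge0 //.
  by rewrite ler_pXn2r ?nnegrE ?(ltW m0) // le_max lexx orbT.
set Z := Y 0; set D := qf Om Z - qf Om (Y T).
have diss : qf (int_mx Q 0 T) Z^T <= (1 + m * T) ^+ 2 * D.
  apply: (dissipation_ge T0 m0 OmT Gm) => //.
  - by move=> s t s0 st _; exact: PT.
  - by move=> s t v s0 st _; exact: int_mx_qf_ge0.
  - by move=> s t v s0 st _; exact: int_mx_qf_le.
  - by move=> s t s0 st _; exact: int_mxD.
  - exact: solution_bounded T0' Ysol.
  - exact: int_mx_mxO.
  - exact: solution_step.
  move=> s t s0 st tT; apply: (lyapunov_rate OmT (PT s t s0 st) lyap).
  rewrite mulmxBl -mulmxA.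
  rewrite (solution_conservation T0' Qint Ysol rG) ?(le_trans st) //.
  by rewrite rY0 mulmx0 subr0.
set z := qf 1%:M Z.
have zE : qf 1%:M Z^T = z by rewrite /z !qf1E trmxK mxtrace_mulC.
have z0 : 0 <= z := qf1_ge0 Z.
have P_ge : eps * z <= qf (int_mx Q 0 T) Z^T.
  apply: (@le_trans _ _ (sigma_min (int_mx Q 0 T) * z)); first by rewrite ler_wpM2r.
  rewrite -zE -qf_scalar -subr_ge0 -qfB; apply: qf_ge0 => v.
  rewrite qfB qf_scalar subr_ge0; apply: sigma_min_qf_le; apply/psdP.
  by split=> [|w]; [exact: PT | exact: int_mx_qf_ge0].
(* Together with [P_ge] this yields eps <= T once z > 0. *)
have P_le : qf (int_mx Q 0 T) Z^T <= T * z.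
  rewrite -zE -qf_scalar -subr_ge0 -qfB; apply: qf_ge0 => v.
  rewrite qfB qf_scalar subr_ge0.
  by have := @int_mx_qf_le _ _ Qint Qb 0 T v (lexx _) T0'; rewrite subr0.
have V_le : qf Om Z <= sigma_max Om * z.
  rewrite -qf_scalar -subr_ge0 -qfB; apply: qf_ge0 => v.
  by rewrite qfB qf_scalar subr_ge0; apply: qf_le_sigma_max; apply/psdP.
have c0 : 0 < (1 + m * T) ^+ 2 by rewrite exprn_gt0 // addr_gt0 ?mulr_gt0.
have D0 : 0 <= D.
  have : 0 <= (1 + m * T) ^+ 2 * D.
    by apply: le_trans diss; apply: le_trans P_ge; rewrite mulr_ge0 // ltW.
  by rewrite pmulr_rge0.
suff : delta eps T / rho G Om * qf Om Z <= D.
  rewrite -/(Y T) -/(Y 0) -/Z /D; lra.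
have d0 : 0 < delta eps T.
  by rewrite lt_min !divr_gt0 ?mulr_gt0 ?exprn_gt0.
have V0 : 0 <= qf Om Z by exact: qf_ge0.
set M := Num.max 1 (g ^+ 3); have M0 : 0 < M by rewrite lt_max ltr01.
rewrite /rho -/g -/M.
(* In this degenerate case the rate is nonpositive (an inverse of 0 being 0), while D >= 0. *)
have [s0|s0] := leP (sigma_max Om) 0.
  apply: le_trans D0; rewrite mulr_le0_ge0 // mulr_ge0_le0 ?(ltW d0) //.
  by rewrite invr_le0 mulr_le0_ge0 // ltW.
have [zz|zN] := eqVneq z 0.
  have -> : qf Om Z = 0.
    by apply/eqP; rewrite eq_le V0 andbT -(mulr0 (sigma_max Om)) -zz.
  by rewrite mulr0.
have {z0 zN} z0 : 0 < z by rewrite lt_def zN.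
have eT : eps <= T by rewrite -(ler_pM2r z0); exact: le_trans P_le.
have dl := delta_le eps0 eT g0; rewrite -/M -/m in dl.
apply: (@le_trans _ _ (delta eps T / M * z)).
  have -> : delta eps T / (sigma_max Om * M) * qf Om Z
            = delta eps T / M * (qf Om Z / sigma_max Om).
    by field; rewrite !gt_eqF.
  by rewrite ler_pM2l ?divr_gt0 // ler_pdivrMr // mulrC.
(* After multiplication by (1 + m T)^2, [delta_le] bounds the left side by eps z, and [P_ge] and
   [diss] link eps z to D. *)
rewrite -(ler_pM2l c0); apply: le_trans diss; apply: le_trans P_ge.
by rewrite mulrA ler_pM2r // mulrC.
Qed.
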